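(* There is an absolute constant $C>0$ such that for every finite set $A\subseteq\mathbb{R}$ with $|A|\ge 4$, the set $f(A)=\{f(a,b,c): a,b,c\in A,\ 0,a,b,c \text{ pairwise distinct}\}$, where $f(a,b,c)=X(0,a,b,c)$ and $X$ denotes the cross ratio, satisfies $$|f(A)|\ \ge\ C\,\frac{|A|^2}{\log |A|}.$$
   Context: For pairwise distinct $a,b,c,d\in\mathbb{R}$ the cross ratio is the real number $$X(a,b,c,d)=\frac{(a-b)(c-d)}{(b-c)(a-d)}.$$ It is defined only for pairwise distinct arguments, so $f(a,b,c)=X(0,a,b,c)$ is defined only when $a,b,c$ are nonzero and pairwise distinct. Here $|S|$ denotes the cardinality of a finite set $S$, and $\log$ is the natural logarithm. *)

(* Defs.v *)
From HB Require Import structures.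
From mathcomp Require Import all_boot all_order all_algebra.
From mathcomp Require Import finmap.
From mathcomp Require Import reals exp.

Set Implicit Arguments.
Unset Strict Implicit.
Unset Printing Implicit Defensive.

Import Order.TTheory GRing.Theory Num.Theory.

Local Open Scope ring_scope.
Local Open Scope fset_scope.

(* Meaningful only when a, b, c, d are pairwise distinct; elsewhere the value
   is whatever division by zero yields. *)
Definition cross_ratio (R : realType) (a b c d : R) : R :=
  ((a - b) * (c - d)) / ((b - c) * (a - d)).

Definition cross_ratio0 (R : realType) (a b c : R) : R := cross_ratio 0 a b c.

(* The uniq filter discards the triples at which cross_ratio0 is undefined;
   A itself may contain 0. *)
Definition cross_ratio0_set (R : realType) (A : {fset R}) : {fset R} :=
  [fset cross_ratio0 t.1.1 t.1.2 t.2
  | t in A `*` A `*` A & uniq [:: 0; t.1.1; t.1.2; t.2]].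

(* Main.v *)
(* In the coordinates 1/a the values of f are the ratios (z - y) / (y - x) over
   distinct triples. Two triples have equal ratios exactly when the three
   points pairing their entries are collinear, so Cauchy-Schwarz reduces the
   bound to showing that an n * n grid has O(n^4 log n) collinear triples. No
   Szemeredi-Trotter theorem is needed for a grid: cut it into r * r cells of
   (n / r)^2 points. A line with k points meets fewer than 2 r cells, so for r
   close to k / 4 it has at least k pairs of points in a common cell, while any
   such pair lies on one line, and there are at most 4 n^4 / r^2 of them.
   Taking r over the powers of 2 bounds the sum of k^3 over all lines. *)
Require Import Defs.
From HB Require Import structures.
From mathcomp Require Import all_boot all_order all_algebra.
From mathcomp Require Import finmap zify ring lra.
From mathcomp Require Import reals exp.

Import Order.TTheory GRing.Theory Num.Theory.

Set Implicit Arguments.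
Unset Strict Implicit.
Unset Printing Implicit Defensive.

(** * Cauchy-Schwarz for colliding pairs *)

(** Cauchy-Schwarz over the fibres of [h]: the fibre sizes sum to [#|D|], their squares to the
    number of ordered colliding pairs, diagonal included. *)
Lemma card_sq_le_collisions (T : finType) (U : eqType) (D : {set T})
    (h : T -> U) (V : seq U) :
  {in D, forall t, h t \in V} ->
  #|D| ^ 2 <= size V *
    #|[set w : T * T | [&& w.1 \in D, w.2 \in D & h w.1 == h w.2]]|.
Proof.
wlog uV : V / uniq V => [hw DV|DV].
  apply: leq_trans (hw (undup V) (undup_uniq V) _) _ => [t tD|].
    by rewrite mem_undup DV.
  by rewrite leq_mul2r size_undup orbT.
pose c v := \sum_(t in D) (h t == v : nat).
have sum_at_value (u : U) : u \in V -> \sum_(v <- V) (u == v : nat) = 1.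
  move=> uinV; transitivity (count_mem u V); last by rewrite count_uniq_mem ?uinV.
  by rewrite -sum1_count [RHS]big_mkcond; apply: eq_bigr => v _; rewrite eq_sym /=; case: (_ == _).
have cD : #|D| = \sum_(v <- V) c v.
  rewrite /c exchange_big -sum1_card; apply: eq_bigr => t tD /=.
  by rewrite sum_at_value ?DV.
have -> : #|[set w : T * T | [&& w.1 \in D, w.2 \in D & h w.1 == h w.2]]|
    = \sum_(v <- V) c v ^ 2.
  under eq_bigr do rewrite -mulnn /c big_distrlr /=.
  rewrite -sum1_card [RHS]exchange_big /=.
  under [RHS]eq_bigr do rewrite exchange_big /=.
  rewrite pair_big_dep /= big_mkcond [RHS]big_mkcond /=.
  apply: eq_bigr => -[t t'] _ /=; rewrite inE /=.
  case: (boolP (t \in D)) => //= tD; case: (boolP (t' \in D)) => //= t'D.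
  rewrite [RHS](eq_bigr (fun v => (h t == v) * (h t == h t'))); last first.
    by move=> v _; case: eqP => //= <-; rewrite [h t' == _]eq_sym.
  by rewrite -big_distrl /= sum_at_value ?DV // mul1n; case: (_ == _).
(* Both sides are doubled so that [2ab <= a^2 + b^2] applies term by term to the double sum. *)
rewrite cD -(leq_pmul2l (ltn0Sn 1)).
have -> : (\sum_(v <- V) c v) ^ 2 = \sum_(v <- V) \sum_(w <- V) c v * c w.
  by rewrite -mulnn big_distrlr.
have E : 2 * (size V * \sum_(v <- V) c v ^ 2)
    = \sum_(v <- V) \sum_(w <- V) (c v ^ 2 + c w ^ 2).
  under [RHS]eq_bigr do rewrite big_split /= big_const_seq count_predT iter_addn_0.
  by rewrite big_split /= big_const_seq count_predT iter_addn_0 -big_distrl /=; lia.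
rewrite E big_distrr /=; apply: leq_sum => v _; rewrite big_distrr /=.
by apply: leq_sum => w _; rewrite nat_Cauchy.
Qed.

(** * Cells of the index grid and monotone chains *)

Definition same_block (s : nat) (n : nat) (w : 'I_n * 'I_n) :=
  w.1 %/ s == w.2 %/ s.

(** Within a block, the residue modulo [s] of the second index determines it. *)
Lemma card_same_block (n s : nat) : 0 < s ->
  #|[set w : 'I_n * 'I_n | same_block s w]| <= n * s.
Proof.
move=> s0.
pose g (w : 'I_n * 'I_n) : 'I_n * 'I_s := (w.1, Ordinal (ltn_pmod w.2 s0)).
rewrite -[X in X * s]card_ord -[X in _ * X]card_ord -card_prod.
rewrite -(card_in_imset (f := g)) ?max_card // => -[i j] [i' j'].
rewrite !inE /same_block /= => /eqP ij /eqP ij' [ii' jj'].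
congr (_, _) => //; apply: val_inj => /=.
by rewrite (divn_eq j s) (divn_eq j' s) -ij -ij' ii' jj'.
Qed.

Definition same_cell (s : nat) (n : nat)
    (w : ('I_n * 'I_n) * ('I_n * 'I_n)) :=
  same_block s (w.1.1, w.2.1) && same_block s (w.1.2, w.2.2).

Lemma card_same_cell (n s : nat) : 0 < s ->
  #|[set w : ('I_n * 'I_n) * ('I_n * 'I_n) | same_cell s w]| <= (n * s) ^ 2.
Proof.
move=> s0; pose B := [set w : 'I_n * 'I_n | same_block s w].
apply: (@leq_trans #|setX B B|); last first.
  by rewrite cardsX -mulnn leq_mul ?card_same_block.
pose g (w : ('I_n * 'I_n) * ('I_n * 'I_n)) := ((w.1.1, w.2.1), (w.1.2, w.2.2)).
rewrite -(card_imset (f := g)); last by move=> [[? ?] [? ?]] [[? ?] [? ?]] [-> -> -> ->].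
apply/subset_leq_card/subsetP => _ /imsetP[w + ->].
by rewrite !inE.
Qed.

(** The diagonal is left out so that a pair of points can be charged to a single line. *)
Definition cell_pairs (s : nat) (n : nat) (S : {set 'I_n * 'I_n}) :=
  [set w : ('I_n * 'I_n) * ('I_n * 'I_n) |
    [&& w.1 \in S, w.2 \in S, w.1 != w.2 & same_cell s w]].

(** This is all that the cell count uses of a line of nonzero slope: either coordinate is a strictly
    monotone function of the other. *)
Definition chain (n : nat) (S : {set 'I_n * 'I_n}) :=
  (forall p q, p \in S -> q \in S -> (p.1 < q.1) = (p.2 < q.2))
  \/ (forall p q, p \in S -> q \in S -> (p.1 < q.1) = (q.2 < p.2)).

Lemma card_chain_le (n : nat) (S : {set 'I_n * 'I_n}) : chain S -> #|S| <= n.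
Proof.
move=> Sch; rewrite -[X in _ <= X]card_ord.
rewrite -(card_in_imset (f := fst)) ?max_card // => p q pS qS e1.
have e2 : p.2 = q.2.
  apply: val_inj => /=; case: Sch => Sch;
    have := Sch _ _ pS qS; have := Sch _ _ qS pS; rewrite e1 ltnn;
    by case: ltngtP.
by move: e1 e2; case: (p) (q) => [? ?] [? ?] /= -> ->.
Qed.

(* The sum of the cell coordinates (one of them reversed for a decreasing
   chain) separates the cells visited by a chain and takes at most [2 r - 1]
   values. *)
Lemma chain_cells (n r s : nat) (S : {set 'I_n * 'I_n}) :
  0 < s -> n < r * s -> chain S ->
  #|S| ^ 2 <= (r.*2).-1 * (#|S| + #|cell_pairs s S|).
Proof.
move=> s0 nrs Sch.
have blk (i : 'I_n) : i %/ s < r by rewrite ltn_divLR // (ltn_trans _ nrs).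
have [g g_lt g_sep] : exists2 g : 'I_n * 'I_n -> nat,
    forall p, g p < (r.*2).-1
    & {in S &, forall p q, g p = g q -> same_cell s (p, q)}.
  have mono (i j : 'I_n) : i %/ s < j %/ s -> i < j.
    by rewrite !ltnNge; apply: contra => ij; exact: leq_div2r.
  case: Sch => Sch.
    exists (fun p : 'I_n * 'I_n => p.1 %/ s + p.2 %/ s) => [p|p q pS qS].
      by have := blk p.1; have := blk p.2; lia.
    have mono2 p' q' : p' \in S -> q' \in S ->
        p'.1 %/ s < q'.1 %/ s -> p'.2 %/ s <= q'.2 %/ s.
      by move=> p'S q'S /mono; rewrite Sch // => /ltnW/leq_div2r.
    have := mono2 _ _ qS pS; have := mono2 _ _ pS qS; rewrite /same_cell /same_block /=.
    move: (p.1 %/ s) (q.1 %/ s) (p.2 %/ s) (q.2 %/ s) => a b c d; lia.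
  (* The truncated subtraction is exact, since [blk] bounds block indices by [r.-1]. *)
  exists (fun p : 'I_n * 'I_n => p.1 %/ s + (r.-1 - p.2 %/ s)) => [p|p q pS qS].
    have := blk p.1; have := blk p.2; move: (p.1 %/ s) (p.2 %/ s) => a b.
    clear -r; lia.
  have mono2 p' q' : p' \in S -> q' \in S ->
      p'.1 %/ s < q'.1 %/ s -> q'.2 %/ s <= p'.2 %/ s.
    by move=> p'S q'S /mono; rewrite Sch // => /ltnW/leq_div2r.
  have := mono2 _ _ qS pS; have := mono2 _ _ pS qS.
  have := blk p.2; have := blk q.2; rewrite /same_cell /same_block /=.
  move: (p.1 %/ s) (q.1 %/ s) (p.2 %/ s) (q.2 %/ s) => a b c d; lia.
have gV : {in S, forall p, g p \in iota 0 (r.*2).-1}.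
  by move=> p _; rewrite mem_iota /= add0n.
(* A pair colliding under [g] is either diagonal, which accounts for [#|S|], or a member of
   [cell_pairs s S]. *)
apply: leq_trans (card_sq_le_collisions gV) _; rewrite size_iota leq_mul2l.
apply/orP; right; rewrite -(card_imset S (f := fun p => (p, p))); last by move=> p q [].
apply: leq_trans (leq_card_setU _ _).
apply/subset_leq_card/subsetP => -[p q]; rewrite !inE /= => /and3P[pS qS /eqP e].
have [<-|pq] := eqVneq p q; first by rewrite imset_f.
by rewrite pS qS g_sep ?orbT.
Qed.

(** * Sums of cubes of chain sizes *)

(** One scale of the sum suffices. For [k = #|S|] at least 4, take [2 ^ j] between [k / 8] and
    [k / 4]: then [chain_cells] leaves at least [k] pairs in common cells, while
    [k ^ 2 <= 64 * 4 ^ j]. *)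
Lemma card_chain_cube (n : nat) (S : {set 'I_n * 'I_n}) :
  chain S -> 1 < #|S| ->
  #|S| ^ 3 <= 64 * \sum_(0 <= j < (trunc_log 2 n).+1)
                      4 ^ j * #|cell_pairs (n %/ 2 ^ j).+1 S|.
Proof.
move=> Sch k2; set k := #|S| in k2 *.
have kn : k <= n := card_chain_le Sch.
pose j := trunc_log 2 (k %/ 4).
have r0 : 0 < 2 ^ j by rewrite expn_gt0.
have jn : j <= trunc_log 2 n.
  by apply: leq_trunc_log; apply: leq_trans (leq_div _ _) kn.
have kr : k < 8 * 2 ^ j.
  have : k %/ 4 < 2 ^ j.+1 by exact: trunc_log_ltn.
  by rewrite expnS ltn_divLR //; lia.
rewrite (bigD1_seq j) ?iota_uniq ?mem_index_iota //=.
apply: leq_trans (leq_mul (leqnn _) (leq_addr _ _)).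
have nrs : n < 2 ^ j * (n %/ 2 ^ j).+1 by rewrite mulnC ltn_ceil.
have := chain_cells (ltn0Sn _) nrs Sch; rewrite -/k.
set P := #|cell_pairs _ _| => kP.
have {}kP : k <= P.
  (* For [k < 4], [trunc_log 2 0 = 0] makes the whole grid one cell, and [k ^ 2 <= k + P] with
     [2 <= k] is enough. *)
  have [k4|k4] := ltnP k 4.
    have j0 : j = 0 by rewrite /j divn_small.
    by move: kP; rewrite j0 expn0 /=; nia.
  have rk : 4 * 2 ^ j <= k.
    have : 2 ^ j <= k %/ 4 by rewrite trunc_logP // divn_gt0.
    by rewrite leq_divRL //; lia.
  by move: kP; move: (2 ^ j) rk r0 => r; nia.
have -> : 4 ^ j = (2 ^ j) ^ 2 by rewrite -expnM mulnC expnM.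
move: (2 ^ j) kr => r kr.
have k64 : k ^ 2 <= 64 * r ^ 2 by nia.
by rewrite expnSr mulnA leq_mul.
Qed.

(** Two distinct points lie in at most one member of [F], so at each scale the pairs of all chains
    together are at most the pairs of grid points in a common cell. *)
Lemma sum_card_chain_cube (n : nat) (F : {set {set 'I_n * 'I_n}}) :
  {in F, forall S, chain S /\ 1 < #|S|} ->
  (forall S S' p q, S \in F -> S' \in F -> p != q ->
     p \in S -> q \in S -> p \in S' -> q \in S' -> S = S') ->
  \sum_(S in F) #|S| ^ 3 <= 256 * n ^ 4 * (trunc_log 2 n).+1.
Proof.
move=> Fch Flin.
have [n0|n0] := posnP n.
  by rewrite big1 // => S _; rewrite eq_card0 // => -[[i ltin] ?]; exfalso; lia.
apply: (@leq_trans (\sum_(S in F) 64 * \sum_(0 <= j < (trunc_log 2 n).+1)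
                      4 ^ j * #|cell_pairs (n %/ 2 ^ j).+1 S|)).
  by apply: leq_sum => S SF; have [Sch S2] := Fch _ SF; exact: card_chain_cube.
rewrite -big_distrr exchange_big /=.
have -> : 256 * n ^ 4 * (trunc_log 2 n).+1
    = 64 * \sum_(0 <= j < (trunc_log 2 n).+1) 4 * n ^ 4.
  by rewrite sum_nat_const_nat subn0; lia.
rewrite leq_mul2l /= !big_mkord; apply: leq_sum => -[j jn] _ /=.
rewrite -big_distrr /=; set s := (n %/ 2 ^ j).+1.
have rn : 2 ^ j <= n by apply: leq_trans (trunc_logP (ltnSn 1) n0); rewrite leq_pexp2l.
(* The successor in [s] adds only [2 ^ j <= n]; each scale thus contributes at most [4 * n ^ 4]. *)
have rs : 2 ^ j * s <= 2 * n.
  by rewrite /s mulnS; have := leq_trunc_div n (2 ^ j); lia.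
apply: (@leq_trans (4 ^ j * (n * s) ^ 2)); last first.
  have -> : 4 ^ j = (2 ^ j) ^ 2 by rewrite -expnM mulnC expnM.
  have : (2 ^ j * s) ^ 2 <= (2 * n) ^ 2 by rewrite leq_exp2r.
  rewrite !expnMn (expnD n 2 2) => h.
  by rewrite mulnCA [leqRHS]mulnCA leq_mul2l h orbT.
rewrite leq_mul2l; apply/orP; right.
apply: leq_trans (@card_same_cell n s (ltn0Sn _)).
under eq_bigr do rewrite -sum1_card big_mkcond /=.
rewrite exchange_big -sum1_card [leqRHS]big_mkcond /=; apply: leq_sum => -[p q] _.
rewrite -big_mkcondr /= sum1_card inE.
case: (boolP (same_cell _ _)) => [_|ncell]; last first.
  by rewrite eq_card0 // => S; rewrite unfold_in /= inE /= (negbTE ncell) !andbF.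
apply/card_le1_eqP => S S' /andP[SF +] /andP[S'F]; rewrite !inE.
move=> /and4P[pS qS pq _] /and4P[pS' qS' _ _].
exact: Flin S'F SF pq pS' qS' pS qS.
Qed.

(** * Lines in a grid of real numbers *)

Local Open Scope ring_scope.

Lemma mono_ord_inj (R : realFieldType) (n : nat) (x : 'I_n -> R) :
  (forall i j : 'I_n, (x i < x j) = (i < j)%N) -> injective x.
Proof.
move=> x_mono i j e; apply: val_inj; have := x_mono i j; have := x_mono j i.
by rewrite e ltxx; case: ltngtP.
Qed.

(** Points are index pairs, so for increasing [x] the cells cut the grid by rank and their sizes do
    not depend on the spacing of the values. *)
Definition grid_line (R : realFieldType) (n : nat) (x : 'I_n -> R) (m c : R)
  : {set 'I_n * 'I_n} := [set p | x p.2 == m * x p.1 + c].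

Lemma chain_grid_line (R : realFieldType) (n : nat) (x : 'I_n -> R) (m c : R) :
  (forall i j : 'I_n, (x i < x j) = (i < j)%N) -> m != 0 ->
  chain (grid_line x m c).
Proof.
move=> x_mono; rewrite neq_lt => /orP[m0|m0]; [right|left] => p q;
  rewrite !inE => /eqP ep /eqP eq; rewrite -!x_mono ep eq ltrD2r.
  by rewrite ltr_nM2l.
by rewrite ltr_pM2l.
Qed.

(** Distinct points of a line [y = m x + c] have distinct abscissas, so they determine [m] and then
    [c]. *)
Lemma grid_line_inj (R : realFieldType) (n : nat) (x : 'I_n -> R)
    (m c m' c' : R) (p q : 'I_n * 'I_n) :
  injective x -> p != q ->
  p \in grid_line x m c -> q \in grid_line x m c ->
  p \in grid_line x m' c' -> q \in grid_line x m' c' ->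
  grid_line x m c = grid_line x m' c'.
Proof.
move=> x_inj pq; rewrite !inE => /eqP e1 /eqP e2 /eqP e3 /eqP e4.
have d0 : x p.1 - x q.1 != 0.
  rewrite subr_eq0; apply: contra_neq pq => e.
  have e' : x p.2 = x q.2 by rewrite e1 e2 e.
  by move/x_inj: e; move/x_inj: e'; case: (p) (q) => [? ?] [? ?] /= -> ->.
have em : m = m' by apply: (mulIf d0); lra.
by have -> : c = c'; [move: e3; rewrite e1 em; lra | rewrite em].
Qed.

Definition line_slope (R : realFieldType) (n : nat) (x : 'I_n -> R)
  (p q : 'I_n * 'I_n) : R := (x q.2 - x p.2) / (x q.1 - x p.1).

Definition line_through (R : realFieldType) (n : nat) (x : 'I_n -> R)
    (p q : 'I_n * 'I_n) :=
  grid_line x (line_slope x p q) (x p.2 - line_slope x p q * x p.1).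

(** For injective [x], requiring both coordinates to differ keeps out vertical lines, whose slope
    would divide by zero, and horizontal ones, which need not be chains. *)
Definition grid_lines (R : realFieldType) (n : nat) (x : 'I_n -> R)
  : {set {set 'I_n * 'I_n}} :=
  [set line_through x w.1 w.2 |
    w in [set w : ('I_n * 'I_n) * ('I_n * 'I_n) |
           (w.1.1 != w.2.1) && (w.1.2 != w.2.2)]].

Lemma sum_card_grid_lines_cube (R : realFieldType) (n : nat) (x : 'I_n -> R) :
  (forall i j : 'I_n, (x i < x j) = (i < j)%N) ->
  (\sum_(S in grid_lines x) #|S| ^ 3 <= 256 * n ^ 4 * (trunc_log 2 n).+1)%N.
Proof.
move=> x_mono.
have x_inj := mono_ord_inj x_mono.
apply: sum_card_chain_cube => [S|S S' p q].
  case/imsetP=> -[p q]; rewrite inE /= => /andP[n1 n2] ->.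
  have d1 : x q.1 - x p.1 != 0 by rewrite subr_eq0 (inj_eq x_inj) eq_sym.
  have d2 : x q.2 - x p.2 != 0 by rewrite subr_eq0 (inj_eq x_inj) eq_sym.
  split; first by apply: chain_grid_line; rewrite // mulf_neq0 ?invr_eq0.
  apply/card_gt1P; exists p, q; split.
  - by rewrite inE; apply/eqP; ring.
  - by rewrite inE /line_slope; apply/eqP; field.
  - by apply: contraNneq n1 => ->.
case/imsetP=> w _ -> /imsetP[w' _ ->] pq *.
exact: (@grid_line_inj _ _ _ _ _ _ _ p q).
Qed.

(** * Equal ratios and collinear triples *)

Definition distinct_triples (n : nat) : {set 'I_n * 'I_n * 'I_n} :=
  [set t | uniq [:: t.1.1; t.1.2; t.2]].

Lemma card_distinct_triples (n : nat) :
  (n ^_ 3 <= #|distinct_triples n|)%N.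
Proof.
rewrite -[X in (X ^_ _)%N]card_ord -card_uniq_tuples.
pose g (t : 3.-tuple 'I_n) := (tnth t 0, tnth t 1, tnth t 2%:R).
rewrite -(card_imset (f := g)); last first.
  move=> t u [e0 e1 e2]; apply: eq_from_tnth => -[[|[|[|//]]] i3].
  - by have -> : Ordinal i3 = 0 by exact: val_inj.
  - by have -> : Ordinal i3 = 1 by exact: val_inj.
  - by have -> : Ordinal i3 = 2%:R by exact: val_inj.
apply/subset_leq_card/subsetP => _ /imsetP[t + ->].
rewrite inE => /andP[_]; rewrite inE.
by case: t => -[|a [|b [|c []]]] //= s3; rewrite !(tnth_nth a) /=.
Qed.

Definition ratio (R : realFieldType) (n : nat) (x : 'I_n -> R)
  (t : 'I_n * 'I_n * 'I_n) : R :=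
  (x t.2 - x t.1.2) / (x t.1.2 - x t.1.1).

(** If both triples have ratio [rho], the step from [(b, b')] to [(c, c')] is [rho] times the step
    from [(a, a')] to [(b, b')], so the three points share a line. Distinct entries put that line in
    [grid_lines]. *)
Lemma card_ratio_collisions (R : realFieldType) (n : nat) (x : 'I_n -> R) :
  injective x ->
  (#|[set w : ('I_n * 'I_n * 'I_n) * ('I_n * 'I_n * 'I_n) |
      [&& w.1 \in distinct_triples n, w.2 \in distinct_triples n
        & ratio x w.1 == ratio x w.2]]|
   <= \sum_(S in grid_lines x) #|S| ^ 3)%N.
Proof.
move=> x_inj.
pose g (w : ('I_n * 'I_n * 'I_n) * ('I_n * 'I_n * 'I_n)) :=
  (((w.1.1.1, w.2.1.1), (w.1.1.2, w.2.1.2)), (w.1.2, w.2.2)).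
have g_inj : injective g.
  by move=> [[[? ?] ?] [[? ?] ?]] [[[? ?] ?] [[? ?] ?]] [-> -> -> -> -> ->].
rewrite -(card_imset _ g_inj).
apply: (@leq_trans #|\bigcup_(S in grid_lines x) setX (setX S S) S|); last first.
  elim/big_rec2: _ => [|S k U _ le_Uk]; first by rewrite cards0.
  apply: leq_trans (leq_card_setU _ _) _.
  by apply: leq_add; rewrite // !cardsX expnSr -mulnn.
apply/subset_leq_card/subsetP => _ /imsetP[[[[a b] c] [[a' b'] c']] + ->].
rewrite !inE /= !inE /= !andbT !negb_or.
case/and3P=> /andP[/andP[ab ac] bc] /andP[/andP[ab' ac'] bc'] /eqP.
rewrite /ratio /= => e.
have D i j : i != j -> x j - x i != 0 by rewrite subr_eq0 (inj_eq x_inj) eq_sym.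
apply/bigcupP; exists (line_through x (a, a') (b, b')).
  by apply/imsetP; exists ((a, a'), (b, b')); rewrite // inE /= ab ab'.
rewrite /line_through /line_slope !inE /=.
have dab := D _ _ ab; have dab' := D _ _ ab'.
set m := (x b' - x a') / (x b - x a).
have em : m * (x b - x a) = x b' - x a' by rewrite divfK.
have ec : x c - x b = (x c - x b) / (x b - x a) * (x b - x a) by rewrite divfK.
have ec' : x c' - x b' = (x c - x b) / (x b - x a) * (x b' - x a').
  by rewrite e divfK.
apply/andP; split; [apply/andP; split|]; apply/eqP; first by ring.
  by rewrite -[LHS](subrK (x a')) -em; ring.
rewrite -[LHS](subrK (x b')) ec' -em mulrCA -ec -[X in _ + X](subrK (x a')) -em.
ring.
Qed.

Lemma sq_le_card_ratios (R : realFieldType) (n : nat) (x : 'I_n -> R)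
    (V : seq R) :
  (2 < n)%N -> (forall i j : 'I_n, (x i < x j) = (i < j)%N) ->
  {in distinct_triples n, forall t, ratio x t \in V} ->
  (n ^ 2 <= 81 * 64 * (size V * (trunc_log 2 n).+1))%N.
Proof.
move=> n3 x_mono xV.
have x_inj := mono_ord_inj x_mono.
have := leq_trans (card_ratio_collisions x_inj) (sum_card_grid_lines_cube x_mono).
have := card_sq_le_collisions xV; have := card_distinct_triples n.
move: #|_| #|distinct_triples n| => Q N nN NQ QL.
(* The constant [2 / 9] is the value of [n (n - 1) (n - 2) / n ^ 3] at [n = 3], its minimum for
   [n >= 3]. *)
have nN9 : (2 * n ^ 3 <= 9 * N)%N.
  apply: leq_trans (leq_mul (leqnn 9%N) nN).
  have [k ->] : exists k, n = k.+3 by exists (n - 3)%N; lia.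
  rewrite !ffactnS ffactn0 muln1 /=; nia.
have {}nN9 : (4 * n ^ 6 <= 81 * N ^ 2)%N.
  have : ((2 * n ^ 3) ^ 2 <= (9 * N) ^ 2)%N by rewrite leq_exp2r.
  by rewrite expnMn -expnM [leqRHS]expnMn.
have {}NQ : (4 * n ^ 6 <= 81 * (size V * (256 * n ^ 4 * (trunc_log 2 n).+1)))%N.
  apply: leq_trans nN9 _; rewrite leq_mul2l /=.
  by apply: leq_trans NQ _; rewrite leq_mul2l QL orbT.
rewrite -(@leq_pmul2l (4 * n ^ 4)%N) ?muln_gt0 ?expn_gt0 /=; last by lia.
by move: NQ; rewrite (expnD n 4 2); nia.
Qed.

(** * Natural logarithms and the final bound *)

(** One [ln m] bounds the logarithm of [2 ^ trunc_log 2 n], the other absorbs the successor, as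
    [2 <= m]. *)
Lemma trunc_log2_le_ln (R : realType) (n m : nat) :
  (0 < n)%N -> (n <= m)%N -> (1 < m)%N ->
  (trunc_log 2 n).+1%:R * ln 2 <= 2 * ln (m%:R : R).
Proof.
move=> n0 nm m1.
have le_ln (k : nat) : (0 < k)%N -> (k <= m)%N -> ln (k%:R : R) <= ln m%:R.
  by move=> k0 km; rewrite ler_ln ?posrE ?ltr0n ?ler_nat //; lia.
have h2 : ln (2 : R) <= ln m%:R by exact: le_ln.
have : ln ((2 ^ trunc_log 2 n)%:R : R) <= ln m%:R.
  by apply: le_ln; rewrite ?expn_gt0 // (leq_trans _ nm) // trunc_logP.
by rewrite natrX lnXn ?ltr0n // -[_ *+ _]mulr_natl -natr1 mulrDl mul1r; lra.
Qed.

Local Open Scope fset_scope.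

Theorem theorem1 (R : realType) :
  exists2 C : R, 0 < C &
    forall A : {fset R}, (4 <= #|` A|)%N ->
      C * ((#|` A|)%:R ^+ 2 / ln (#|` A|)%:R)
        <= (#|` cross_ratio0_set A|)%:R.
Proof.
have ln2 : 0 < ln (2 : R) by rewrite ln_gt0 // ltr1n.
(* [20736 = 81 * 64 * 2 * 2]: one 2 comes from passing from [A] to [s], the other from
   [trunc_log2_le_ln]. *)
exists (ln 2 / 20736) => [|A A4]; first by rewrite divr_gt0.
pose s := sort <=%O [seq a^-1 | a <- enum_fset A & a != 0].
have s_lt : sorted <%O s.
  rewrite sort_lt_sorted map_inj_uniq; last exact: invr_inj.
  by rewrite filter_uniq ?fset_uniq.
have s_le : (size s <= #|` A|)%N.
  by rewrite size_sort size_map size_filter count_size.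
(* Only 0 can be lost on inverting [A]. *)
have s_ge : (#|` A| <= (size s).+1)%N.
  rewrite size_sort size_map size_filter.
  rewrite -(count_predC (pred1 0) (enum_fset A)) count_uniq_mem ?fset_uniq //.
  by rewrite -add1n leq_add2r leq_b1.
pose x (i : 'I_(size s)) := s`_i.
have x_mono i j : (x i < x j) = (i < j)%N.
  by rewrite /x lt_sorted_ltn_nth ?inE.
have x_mem i : exists a, [/\ a \in A, a != 0 & x i = a^-1].
  have : x i \in s by exact: mem_nth.
  by rewrite mem_sort => /mapP[a]; rewrite mem_filter => /andP[a0 aA] ->; exists a.
have ratio_mem : {in distinct_triples (size s),
    forall t, ratio x t \in enum_fset (cross_ratio0_set A)}.
  move=> [[i j] k]; rewrite inE /= !inE !negb_or andbT.
  case/andP=> /andP[ij ik] jk; rewrite /ratio /=.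
  have x_inj := mono_ord_inj x_mono.
  move: ij ik jk; rewrite -!(inj_eq x_inj).
  have [a [aA a0 ->]] := x_mem i; have [b [bA b0 ->]] := x_mem j.
  have [c [cA c0 ->]] := x_mem k; rewrite !(inj_eq invr_inj) => ab ac bc.
  apply/imfsetP; exists ((a, b), c) => /=.
    by rewrite !inE /= aA bA cA ![0 == _]eq_sym (negbTE a0) (negbTE b0)
      (negbTE c0) (negbTE ab) (negbTE ac) (negbTE bc).
  (* Both sides equal [a (b - c) / (c (a - b))]. *)
  rewrite /cross_ratio0 /cross_ratio; field.
  by rewrite a0 b0 c0 subr_eq0 ab.
have s2 : (2 < size s)%N by lia.
have := sq_le_card_ratios s2 x_mono ratio_mem.
have := @trunc_log2_le_ln R (size s) #|` A|.
(* This is [(k + 1) ^ 2 <= 2 * k ^ 2], valid from [k = 3] on. *)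
have : (#|` A| ^ 2 <= 2 * size s ^ 2)%N by nia.
have lnA : 0 < ln (#|` A|%:R : R) by rewrite ln_gt0 // ltr1n; lia.
have n0 : (0 < size s)%N by lia.
have A1 : (1 < #|` A|)%N by lia.
move=> + /(_ n0 s_le A1) hL.
rewrite -(ler_nat R) natrM !natrX => hA; rewrite -(ler_nat R) natrX !natrM => hn.
rewrite mulrA ler_pdivrMr // mulrAC ler_pdivrMr //.
set M : R := (#|` cross_ratio0_set A|)%:R in hn *.
have hML := ler_wpM2l (ler0n R #|` cross_ratio0_set A|) hL.
have := ler_wpM2r (ltW ln2) hA; have := ler_wpM2r (ltW ln2) hn.
by rewrite -/M in hML *; lra.
Qed.
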